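(* Let $\sigma\in(0,2)$, $T>0$, $h>0$, $\tau=T/M$ with $M\in\mathbb{N}$. Assume $F:\mathbb{R}\to\mathbb{R}$ satisfies $F(l_1)-F(l_2)\le L_F(l_1-l_2)^+$ for all $l_1,l_2\in\mathbb{R}$, with a constant $L_F>0$, that $f\in C_b(\mathbb{R}^N\times[0,T])$, $u_0\in C_b(\mathbb{R}^N)$, and that the CFL condition $\tau\le\frac{1}{L_FC_\sigma}h^\sigma$ holds. For $(x,t)\in\mathbb{R}^N\times[0,T]$, $r\in\mathbb{R}$ and bounded $U_h:\mathbb{R}^N\times[0,T]\to\mathbb{R}$ define $$S(h,x,t,r,U_h)=\begin{cases}\dfrac{r-U_h(x,t-\tau)}{\tau}-F\big(-(-\Delta_h)^{\sigma/2}U_h(x,t-\tau)\big)-f(x,t-\tau),&t\in[\tau,T],\\[4pt] r-u_0(x),&t\in[0,\tau).\end{cases}$$ Then $S(h,x,t,r,U_h)$ is nondecreasing in $r$ and nonincreasing in $U_h$ (i.e. $S(h,x,t,r,U_h)\ge S(h,x,t,r,V_h)$ whenever $U_h\le V_h$ pointwise).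
   Context: $(\cdot)^+=\max\{0,\cdot\}$; $C_b$ denotes bounded continuous functions. For bounded $\phi$, $-(-\Delta_h)^{\sigma/2}\phi(x)=\sum_{\mathbf j\in\mathbb{Z}^N\setminus\{0\}}(\phi(x+h\mathbf j)-\phi(x))\kappa_{\sigma,h,\mathbf j}$ (acting in $x$), where $\kappa_{\sigma,h,\mathbf j}=\frac{1}{h^\sigma}\frac{1}{|\Gamma(-\sigma/2)|}\int_0^\infty e^{-2Nt}\prod_{i=1}^NI_{|\mathbf j_i|}(2t)\frac{dt}{t^{1+\sigma/2}}\ge0$ and $I_m$ is the modified Bessel function of the first kind of order $m$. (Equivalently $-(-\Delta_h)^{\sigma/2}=\frac{1}{|\Gamma(-\sigma/2)|}\int_0^\infty(e^{t\Delta_h}-\mathrm{Id})\frac{dt}{t^{1+\sigma/2}}$ with $\Delta_h$ the standard second order central difference Laplacian of step $h$.) The constant $C_\sigma>0$ (independent of $h$) is defined by $\sum_{\mathbf j\ne0}\kappa_{\sigma,h,\mathbf j}=C_\sigma h^{-\sigma}$. *)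

(* Defs.v *)
From HB Require Import structures.
From mathcomp Require Import all_boot all_order all_algebra.
From mathcomp Require Import all_classical all_reals all_analysis.
Set Implicit Arguments.
Unset Strict Implicit.
Unset Printing Implicit Defensive.
Import Order.TTheory GRing.Theory Num.Theory.
Import numFieldNormedType.Exports.
Local Open Scope classical_set_scope.
Local Open Scope ring_scope.

Section SpecialFunctions.
Context {R : realType}.

Definition Gamma_Euler (z : R) : R :=
  \int[@lebesgue_measure R]_(t in `]0, +oo[) (t `^ (z - 1) * expR (- t)).

(* For z <= 0, z + n is positive for n := truncn (- z) + 1, and the recurrence
   Gamma (z + 1) = z * Gamma z extends the Euler integral to all z that are not
   nonpositive integers.  At the poles the value is the junk value 0. *)
Definition Gamma (z : R) : R :=
  if 0 < z then Gamma_Euler z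
  else let n := (Num.truncn (- z)).+1 in
    Gamma_Euler (z + n%:R) / \prod_(i < n) (z + i%:R).

Definition BesselI (m : nat) (x : R) : R :=
  limn (series (fun k : nat =>
    (x / 2) ^+ (k.*2 + m) / (k`!%:R * (k + m)`!%:R))).

End SpecialFunctions.

(* Sum of an absolutely summable real family (see esumB for the convention). *)
Definition rsum {R : realType} {I : choiceType} (A : set I) (a : I -> R) : R :=
  fine (\esum_(i in A) ((EFin \o a)^\+ i)%E)
  - fine (\esum_(i in A) ((EFin \o a)^\- i)%E).

Section DiscreteFractionalLaplacian.
Context {R : realType} {N : nat}.

Definition kappa (sigma h : R) (j : 'rV[int]_N) : R :=
  (h `^ sigma)^-1 * `|Gamma (- (sigma / 2))|^-1 *
  \int[@lebesgue_measure R]_(t in `]0, +oo[)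
    (expR (- (2 * N%:R * t)) * \prod_(i < N) BesselI `|j ord0 i|%N (2 * t)
     / t `^ (1 + sigma / 2)).

Definition nonzero_lattice : set 'rV[int]_N := [set j | j != 0].

Definition lattice_point (h : R) (j : 'rV[int]_N) : 'rV[R]_N :=
  h *: map_mx intr j.

(* This is - (- Delta_h)^(sigma/2), including the leading minus sign. *)
Definition neg_frac_lap (sigma h : R) (phi : 'rV[R]_N -> R) (x : 'rV[R]_N) : R :=
  rsum nonzero_lattice
    (fun j => (phi (x + lattice_point h j) - phi x) * kappa sigma h j).

End DiscreteFractionalLaplacian.

(* The constant is read off at h = 1; Csigma_spec gives its defining equation
   for every h. *)
Definition Csigma {R : realType} (N : nat) (sigma : R) : R :=
  rsum (@nonzero_lattice N) (kappa sigma 1).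

Section CsigmaSpec.
Context {R : realType}.

Lemma ereal_sup_pZl (c : R) (S : set (\bar R)) : 0 < c ->
  (ereal_sup [set c%:E * x | x in S] = c%:E * ereal_sup S)%E.
Proof.
move=> c0; apply/eqP; rewrite eq_le; apply/andP; split.
- apply: ge_ereal_sup => _ [x Sx <-].
  by rewrite lee_pmul2l //; exact: ereal_sup_ubound.
- rewrite -lee_pdivlMl//; apply: ge_ereal_sup => x Sx.
  by rewrite lee_pdivlMl//; apply: ereal_sup_ubound; exists x.
Qed.

Lemma esum_pZl (I : choiceType) (A : set I) (a : I -> \bar R) (c : R) :
  0 < c -> (forall i, (0 <= a i)%E) ->
  (\esum_(i in A) (c%:E * a i) = c%:E * \esum_(i in A) a i)%E.
Proof.
move=> c0 a0; rewrite /esum -ereal_sup_pZl//; congr ereal_sup.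
have scale F : finite_set F ->
    (\sum_(i \in F) (c%:E * a i) = c%:E * \sum_(i \in F) a i)%E.
  by move=> finF; rewrite !fsbig_finite//= ge0_sume_distrr.
apply/seteqP; split => [_ [F [finF FA] <-]|_ [_ [F [finF FA] <-] <-]] /=.
- by exists (\sum_(i \in F) a i)%E; [exists F|rewrite scale].
- by exists F => //; rewrite scale.
Qed.

Lemma rsum_pZl (I : choiceType) (A : set I) (a : I -> R) (c : R) :
  0 < c -> rsum A (fun i => c * a i) = c * rsum A a.
Proof.
move=> c0; rewrite /rsum mulrBr.
have fineZ (x : \bar R) : (fine (c%:E * x) = c * fine x)%R.
  case: x => [r| |] //=.
  - by rewrite mulry gtr0_sg// mul1e mulr0.
  - by rewrite mulrNy gtr0_sg// mul1e mulr0.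
rewrite -!fineZ -!esum_pZl//.
have -> : (EFin \o (fun i => c * a i)) = (fun i => c%:E * (EFin \o a) i)%E.
  by apply/funext => i /=; rewrite EFinM.
by rewrite ge0_funeposM ?ltW// ge0_funenegM ?ltW.
Qed.

Lemma Csigma_spec (N : nat) (sigma h : R) : 0 < h ->
  rsum (@nonzero_lattice N) (kappa sigma h) = Csigma N sigma * h `^ (- sigma).
Proof.
move=> h0; rewrite mulrC /Csigma -rsum_pZl ?powR_gt0//; congr rsum.
by apply/funext => j; rewrite /kappa powR1 invr1 mul1r powRN !mulrA.
Qed.

End CsigmaSpec.

Definition Cb {R : realType} {X : topologicalType} (A : set X) (g : X -> R) : Prop :=
  {within A, continuous g} /\ [bounded g p | p in A].

(* Functions on R^N x [0,T] are total functions on R^N x R, of which only the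
   values on this set matter. *)
Definition space_time {R : realType} (N : nat) (T : R) : set ('rV[R]_N * R) :=
  [set p | 0 <= p.2 <= T].
Arguments space_time {R} N T _.

(* The two branches are t in [tau, T] and t in [0, tau), for t in [0, T]. *)
Definition scheme {R : realType} {N : nat} (sigma tau : R) (F : R -> R)
    (f : 'rV[R]_N * R -> R) (u0 : 'rV[R]_N -> R)
    (h : R) (x : 'rV[R]_N) (t r : R) (U : 'rV[R]_N * R -> R) : R :=
  if tau <= t then
    (r - U (x, t - tau)) / tau
    - F (neg_frac_lap sigma h (fun y => U (y, t - tau)) x)
    - f (x, t - tau)
  else r - u0 x.

(* Main.v *)
(** For bounded [U <= V], the difference of the discrete fractional Laplacians at
    [x] is [sum_j ((U - V)(x + h j) - (U - V)(x)) kappa_j].  Dropping the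
    nonpositive terms [(U - V)(x + h j) kappa_j] leaves at most
    [(V - U)(x) C_sigma h^(-sigma)].  By the Lipschitz condition and CFL, the
    nonlinear term changes by at most [(V - U)(x) / tau], which the difference
    quotient in time compensates.  Summability of [kappa] comes for free: an infinite
    sum would make [Csigma] equal to [0], and then CFL would read [tau <= 0]. *)
Require Import Defs.
From HB Require Import structures.
From mathcomp Require Import all_boot all_order all_algebra.
From mathcomp Require Import all_classical all_reals all_analysis.
From mathcomp Require Import lra.
Import Order.TTheory GRing.Theory Num.Theory.
Import numFieldNormedType.Exports.
Local Open Scope classical_set_scope.
Local Open Scope ring_scope.

Lemma BesselI_ge0 (R : realType) (m : nat) (x : R) : 0 <= x -> 0 <= BesselI m x.
Proof.
move=> x0; rewrite /BesselI; set s := series _.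
have s0 n : 0 <= s n.
  rewrite /s /series /=; apply: sumr_ge0 => k _.
  by rewrite divr_ge0 ?exprn_ge0 ?mulr_ge0 ?divr_ge0 ?ler0n.
have [cs|dvgs] := pselect (cvgn s).
  by apply: limr_ge => //; exact: nearW.
(* The limit of a divergent real sequence is the default point, which is [0]. *)
by rewrite (dvgP dvgs) lexx.
Qed.

Lemma kappa_ge0 (R : realType) (N : nat) (sigma h : R) (j : 'rV[int]_N) :
  0 <= kappa sigma h j.
Proof.
rewrite /kappa !mulr_ge0 ?invr_ge0 ?powR_ge0 ?normr_ge0//.
apply: Rintegral_ge0 => t /=; rewrite in_itv /= andbT => t0.
rewrite !mulr_ge0 ?expR_ge0 ?invr_ge0 ?powR_ge0//.
by apply: prodr_ge0 => i _; apply: BesselI_ge0; rewrite mulr_ge0// ltW.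
Qed.

Section Rsum.
Context {R : realType} {I : choiceType}.
Implicit Types (A : set I) (a b c w : I -> R).

Lemma ge0_rsumE A a : (forall i, 0 <= a i) ->
  rsum A a = fine (\esum_(i in A) (a i)%:E)%E.
Proof.
move=> a0; rewrite /rsum [X in _ - fine X]esum1 ?subr0; last first.
  by move=> i _; rewrite funenegE /= max_r// lee_fin oppr_le0.
by congr fine; apply: eq_esum => i _; rewrite funeposE /= max_l// lee_fin.
Qed.

(* An infinite sum is mapped to [0] by [fine]. *)
Lemma rsum_gt0_summable A a : (forall i, 0 <= a i) -> 0 < rsum A a ->
  summable A (EFin \o a).
Proof.
move=> a0; rewrite ge0_rsumE// /summable.
have -> : (\esum_(i in A) `|(EFin \o a) i| = \esum_(i in A) (a i)%:E)%E.
  by apply: eq_esum => i _ /=; rewrite ger0_norm.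
by case: (\esum_(i in A) (a i)%:E)%E => [r| |] //=; rewrite ?ltxx// ltry.
Qed.

(** Domination by [B * a]. It is meant for increments of a bounded function, weighted by [kappa]. *)
Lemma summable_bddM A w a (B : R) : 0 < B -> (forall i, 0 <= a i) ->
  (forall i, `|w i| <= B) -> summable A (EFin \o a) ->
  summable A (EFin \o (fun i => w i * a i)).
Proof.
move=> B0 a0 wB sa; rewrite /summable.
apply: (@le_lt_trans _ _ (\esum_(i in A) (B%:E * `|(EFin \o a) i|))%E).
  apply: le_esum => i _ /=.
  by rewrite -EFinM lee_fin normrM ler_pM.
by rewrite esum_pZl// lte_mul_pinfty ?ltW// lee_fin ltW.
Qed.

(** With all negative parts moved to the other side, the termwise inequality relates nonnegative
    families, for which [esum] is monotone and additive. Summability makes the six sums finite, so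
    they can be moved back in [R]. *)
Lemma rsum_leD A a b c :
  summable A (EFin \o a) -> summable A (EFin \o b) -> summable A (EFin \o c) ->
  (forall i, A i -> a i <= b i + c i) -> rsum A a <= rsum A b + rsum A c.
Proof.
move=> sa sb sc abc.
have fin_pos (u : I -> R) : summable A (EFin \o u) ->
    (\esum_(i in A) (EFin \o u)^\+ i)%E \is a fin_num.
  move=> /summable_funepos; rewrite summableE.
  by under eq_esum => i _ do rewrite gee0_abs ?funepos_ge0//.
have fin_neg (u : I -> R) : summable A (EFin \o u) ->
    (\esum_(i in A) (EFin \o u)^\- i)%E \is a fin_num.
  move=> /summable_funeneg; rewrite summableE.
  by under eq_esum => i _ do rewrite gee0_abs ?funeneg_ge0//.
have : (\esum_(i in A) (EFin \o a)^\+ i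
     + (\esum_(i in A) (EFin \o b)^\- i + \esum_(i in A) (EFin \o c)^\- i)
     <= \esum_(i in A) (EFin \o a)^\- i
     + (\esum_(i in A) (EFin \o b)^\+ i + \esum_(i in A) (EFin \o c)^\+ i))%E.
  rewrite -!esumD; try by move=> i _; rewrite ?adde_ge0 ?funepos_ge0 ?funeneg_ge0.
  apply: le_esum => i Ai; rewrite !funeposE !funenegE /=.
  rewrite -!EFin_max -!EFinD lee_fin.
  (* Writing each negative part as the positive part minus the function reduces the goal to [abc],
     linearly. *)
  have maxN (u : R) : Num.max (- u) 0 = Num.max u 0 - u.
    by case: (leP u 0) => [u0|/ltW u0]; [rewrite max_l|rewrite max_r]; lra.
  by rewrite !maxN; have := abc i Ai; lra.
rewrite /rsum.
move: (fin_pos _ sa) (fin_neg _ sa) (fin_pos _ sb) (fin_neg _ sb)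
  (fin_pos _ sc) (fin_neg _ sc).
do 6![move=> /fineK <-].
rewrite -!EFinD lee_fin /=; lra.
Qed.

End Rsum.

Lemma neg_frac_lapB_le (R : realType) (N : nat) (sigma h B : R)
    (phi psi : 'rV[R]_N -> R) (x : 'rV[R]_N) :
  0 < rsum (@nonzero_lattice N) (kappa sigma h) ->
  0 < B -> (forall y, `|phi y| <= B) -> (forall y, `|psi y| <= B) ->
  (forall y, phi y <= psi y) ->
  neg_frac_lap sigma h phi x - neg_frac_lap sigma h psi x <=
  (psi x - phi x) * rsum (@nonzero_lattice N) (kappa sigma h).
Proof.
move=> K0 B0 phiB psiB phipsi.
have k0 := @kappa_ge0 R N sigma h.
have sk := rsum_gt0_summable _ _ k0 K0.
have sM (w : 'rV[int]_N -> R) : (forall j, `|w j| <= B + B) ->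
    summable (@nonzero_lattice N) (EFin \o (fun j => w j * kappa sigma h j)).
  by move=> wB; apply: summable_bddM wB sk => //; rewrite addr_gt0.
have -> : (psi x - phi x) * rsum (@nonzero_lattice N) (kappa sigma h) =
    rsum (@nonzero_lattice N) (fun j => (psi x - phi x) * kappa sigma h j).
  (* [rsum_pZl] asks for a positive factor, so equality of [phi] and [psi] at [x] is treated
     apart. *)
  have := phipsi x; rewrite -subr_ge0 le_eqVlt => /predU1P[<-|d0]; last first.
    by rewrite rsum_pZl.
  rewrite mul0r ge0_rsumE ?esum1//.
  - by move=> j _; rewrite mul0r.
  - by move=> j; rewrite mul0r.
rewrite lerBlDl; apply: rsum_leD.
(* Each weight is a difference of two values of size at most [B], whence [B + B]. *)
- by apply: sM => j; rewrite (le_trans (ler_normB _ _))// lerD.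
- by apply: sM => j; rewrite (le_trans (ler_normB _ _))// lerD.
- by apply: sM => j; rewrite (le_trans (ler_normB _ _))// lerD.
- move=> j _; rewrite -mulrDl ler_wpM2r//.
  by have := phipsi (x + lattice_point h j); lra.
Qed.

Theorem lemma3p7 (R : realType) (N : nat) (hN : (0 < N)%N)
    (sigma T h tau : R) (M : nat)
    (hsigma : 0 < sigma < 2) (hT : 0 < T) (hh : 0 < h)
    (hM : (0 < M)%N) (htau : tau = T / M%:R)
    (F : R -> R) (LF : R) (hLF : 0 < LF)
    (hF : forall l1 l2 : R, F l1 - F l2 <= LF * Num.max 0 (l1 - l2))
    (f : 'rV[R]_N * R -> R) (hf : Cb (space_time N T) f)
    (u0 : 'rV[R]_N -> R) (hu0 : Cb [set: 'rV[R]_N] u0)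
    (hCFL : tau <= 1 / (LF * Csigma N sigma) * h `^ sigma) :
  (forall (x : 'rV[R]_N) (t : R) (U : 'rV[R]_N * R -> R),
      0 <= t <= T -> [bounded U p | p in space_time N T] ->
      forall r1 r2 : R, r1 <= r2 ->
      scheme sigma tau F f u0 h x t r1 U <= scheme sigma tau F f u0 h x t r2 U)
  /\
  (forall (x : 'rV[R]_N) (t r : R) (U V : 'rV[R]_N * R -> R),
      0 <= t <= T ->
      [bounded U p | p in space_time N T] ->
      [bounded V p | p in space_time N T] ->
      (forall p, space_time N T p -> U p <= V p) ->
      scheme sigma tau F f u0 h x t r U >= scheme sigma tau F f u0 h x t r V).
Proof.
have tau0 : 0 < tau by rewrite htau divr_gt0// ltr0n.
(* The CFL bound is positive because [tau] is; since [1 / 0 = 0], this excludes a zero constant as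
   well as a negative one. *)
have C0 : 0 < Csigma N sigma.
  have hs0 : 0 < h `^ sigma by rewrite powR_gt0.
  have := lt_le_trans tau0 hCFL.
  by rewrite pmulr_lgt0// div1r invr_gt0 pmulr_rgt0.
have K0 : 0 < rsum (@nonzero_lattice N) (kappa sigma h).
  by rewrite Csigma_spec// mulr_gt0 ?powR_gt0.
(* The CFL condition, inverted. *)
have tauK : LF * rsum (@nonzero_lattice N) (kappa sigma h) <= tau^-1.
  rewrite -[leLHS]invrK lef_pV2 ?posrE ?invr_gt0 ?mulr_gt0//.
  by rewrite Csigma_spec// powRN mulrA invfM invrK -div1r.
split=> [x t U _ _ r1 r2 r12|x t r U V /andP[t0 tT] bU bV UV];
  rewrite /scheme; case: ifPn => // taut.
- by rewrite !lerD2r ler_wpM2r ?lerD2r ?invr_ge0// ltW.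
- by rewrite lerD2r.
(* The whole slice at time [t - tau] lies in the strip, the only place where bounds and ordering of
   [U] and [V] are known. *)
have st y : space_time N T (y, t - tau).
  by rewrite /space_time /= subr_ge0 taut /= lerBlDr (le_trans tT)// lerDl ltW.
have [A A0 UA] := pinfty_ex_gt0 bU; have [B B0 VB] := pinfty_ex_gt0 bV.
set LU := neg_frac_lap _ _ (fun y => U _) x.
set LV := neg_frac_lap _ _ (fun y => V _) x.
have dL : LU - LV <= (V (x, t - tau) - U (x, t - tau)) *
    rsum (@nonzero_lattice N) (kappa sigma h).
  apply: (@neg_frac_lapB_le _ _ _ _ (A + B)) => //.
  - by rewrite addr_gt0.
  - by move=> y; rewrite (le_trans (UA _ (st y)))// lerDl ltW.
  - by move=> y; rewrite (le_trans (VB _ (st y)))// lerDr ltW.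
  - by move=> y; exact: UV.
set d := V _ - U _ in dL *.
have d0 : 0 <= d by rewrite subr_ge0 UV.
(* Both arms of the maximum in [hF] are at most [d] times the kernel mass: [0] by [d0], the
   difference by [dL]. Then [tauK] applies. *)
have dF : F LU - F LV <= d / tau.
  apply: (le_trans (hF _ _)).
  apply: (@le_trans _ _ (LF * (d * rsum (@nonzero_lattice N) (kappa sigma h)))).
    by rewrite ler_pM2l// ge_max dL andbT mulr_ge0// ltW.
  by rewrite mulrCA ler_wpM2l.
(* The time quotients differ by exactly the bound in [dF], and the [f] terms cancel. *)
have : d / tau = (r - U (x, t - tau)) / tau - (r - V (x, t - tau)) / tau.
  by rewrite -mulrBl /d; congr (_ / _); lra.
rewrite /LU /LV in dF *; lra.
Qed.
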